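(* Let $n,\delta,\ell$ be positive integers. Given a multiset $S$ whose elements are from the universe $U=\{1,2,\dots,n\}$ and in which every element has multiplicity at most $\ell$, any data structure that supports ${\textsf{drankA}}$ queries on $S$ with additive error $\delta$ requires at least $\lfloor n/\lceil\delta/\ell\rceil\rfloor\lg(\max(\lfloor\ell/\delta\rfloor,1)+1)$ bits.
   Context: For a multiset $S$ over $\{1,\dots,n\}$, ${\textsf{rank}}(i,S)=|\{j\in S\mid j\le i\}|$ (counted with multiplicity). ${\textsf{drankA}}(i,S,\delta)$ returns any value $r$ with ${\textsf{rank}}(i,S)-\delta<r\le{\textsf{rank}}(i,S)$. The lower bound is over all multisets satisfying the multiplicity bound $\ell$. *)

(* Defs.v *)
From HB Require Import structures.
From mathcomp Require Import all_boot all_order all_algebra.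
From mathcomp Require Import finmap multiset.
From mathcomp Require Import reals exp.

Set Implicit Arguments.
Unset Strict Implicit.
Unset Printing Implicit Defensive.

Import Order.TTheory GRing.Theory Num.Theory.

Local Open Scope mset_scope.
Local Open Scope ring_scope.

Definition in_universe (n i : nat) : bool := (1 <= i <= n)%N.

Definition bounded_mset (n ell : nat) (S : {mset nat}) : Prop :=
  (forall j, j \in S -> in_universe n j) /\ (forall j, (S j <= ell)%N).

(* [S] is coerced to the sequence of its elements, repeated according to
   multiplicity. *)
Definition rank (i : nat) (S : {mset nat}) : nat := count (fun j => (j <= i)%N) S.

(* Answers are in [int] because [rank i S - delta] may be negative. *)
Definition drankA_answer (delta i : nat) (S : {mset nat}) (r : int) : bool :=
  (rank i S)%:Z - delta%:Z < r <= (rank i S)%:Z.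

(* A data structure occupying [b] bits: [encode] is the preprocessing, which
   turns the input multiset into [b] bits of memory, and [query] answers from
   that memory and the query point alone.  Both may depend on [n], [delta] and
   [ell].  Values outside the admissible inputs are unconstrained. *)
Record drankA_structure (n delta ell b : nat) := DrankAStructure {
  encode : {mset nat} -> b.-tuple bool;
  query : b.-tuple bool -> nat -> int;
  queryP : forall (S : {mset nat}) (i : nat),
    bounded_mset n ell S -> in_universe n i ->
    drankA_answer delta i S (query (encode S) i)
}.

(* The ceiling of m / d, for d > 0. *)
Definition ceil_divn (m d : nat) : nat := ((m + d.-1) %/ d)%N.

Definition lg (R : realType) (x : R) : R := ln x / ln 2.

(* Main.v *)
(* Split the universe into blocks of [c = ceil (delta / ell)] consecutive
   elements and give all elements of block [k] the same multiplicity
   [v_k * min delta ell], with [0 <= v_k <= M = max (floor (ell / delta)) 1].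
   Since [delta <= c * min delta ell], changing a single [v_k] moves the rank at
   the end of block [k] by at least [delta]; so two multisets of this family
   with the same encoding agree block after block.  Hence
   [(M + 1) ^ floor (n / c) <= 2 ^ b]. *)
Require Import Defs.
From HB Require Import structures.
From mathcomp Require Import all_boot all_order all_algebra.
From mathcomp Require Import finmap multiset.
From mathcomp Require Import reals exp.
From mathcomp Require Import zify.

Import Order.TTheory GRing.Theory Num.Theory.
Local Open Scope mset_scope.
Local Open Scope ring_scope.

(* Element [j.+1] has multiplicity [mu j]: [mu] is indexed from 0, the universe
   from 1. *)
Definition mset_of_mult (N : nat) (mu : nat -> nat) : {mset nat} :=
  seq_mset (flatten [seq nseq (mu j) j.+1 | j <- iota 0 N]).

Lemma count_nseqs (a : pred nat) (mu : nat -> nat) (s : seq nat) :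
  count a (flatten [seq nseq (mu j) j.+1 | j <- s])
  = (\sum_(j <- s) a j.+1 * mu j)%N.
Proof.
elim: s => [|j s IHs] /=; first by rewrite big_nil.
by rewrite count_cat count_nseq IHs big_cons.
Qed.

Lemma rank_mset_of_mult (N : nat) (mu : nat -> nat) (i : nat) :
  (i <= N)%N -> rank i (mset_of_mult N mu) = (\sum_(0 <= j < i) mu j)%N.
Proof.
move=> le_iN; rewrite /rank /mset_of_mult.
rewrite (permP (perm_eq_seq_mset _)) count_nseqs.
have -> : iota 0 N = index_iota 0 N by rewrite /index_iota subn0.
rewrite (big_cat_nat (n := i)) //= [X in (_ + X)%N]big_nat_cond.
rewrite [X in (_ + X)%N]big1 ?addn0; last first.
  by move=> j; rewrite andbT => /andP[le_ij _]; rewrite ltnNge le_ij.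
rewrite big_nat_cond [RHS]big_nat_cond; apply: eq_bigr => j.
by rewrite andbT => /= ->; rewrite mul1n.
Qed.

Lemma bounded_mset_of_mult (n ell N : nat) (mu : nat -> nat) :
  (N <= n)%N -> (forall j, mu j <= ell)%N ->
  bounded_mset n ell (mset_of_mult N mu).
Proof.
move=> le_Nn le_mu; split=> j.
  rewrite (perm_mem (perm_eq_seq_mset _)) => /flatten_mapP[k].
  rewrite mem_iota add0n /in_universe => /= lt_kN.
  by rewrite mem_nseq => /andP[_ /eqP ->] /=; apply: leq_trans le_Nn.
rewrite mset_seqE count_nseqs.
(* Only index [j.-1] can contribute to the multiplicity of [j]; it lies in the list exactly when
   [1 <= j <= N]. *)
case: (boolP ((j == 0) || (N < j))%N) => [out|].
  rewrite big_seq big1 // => k; rewrite mem_iota /= => lt_kN.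
  by have /negbTE -> : k.+1 != j by lia.
rewrite negb_or -leqNgt -lt0n => /andP[j_gt0 le_jN].
have mem_j : j.-1 \in iota 0 N by rewrite mem_iota; lia.
rewrite (bigD1_seq j.-1 mem_j (iota_uniq 0 N)) /=.
rewrite prednK // eqxx mul1n big1 ?addn0 // => k ne_kj.
by have /negbTE -> : k.+1 != j by lia.
Qed.

Lemma sum_blocks (c k : nat) (F : nat -> nat) :
  (0 < c)%N ->
  (\sum_(0 <= j < k * c) F (j %/ c) = c * \sum_(0 <= i < k) F i)%N.
Proof.
move=> c_gt0; elim: k => [|k IHk]; first by rewrite mul0n !big_geq ?muln0.
rewrite (big_cat_nat (n := (k * c)%N)) //=; last by rewrite leq_mul2r leqnSn orbT.
rewrite IHk big_nat_recr //= mulnDr; congr addn.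
rewrite (eq_big_nat _ _ (F2 := fun=> F k)) => [|j /andP[le_j lt_j]].
  by rewrite sum_nat_const_nat mulSn addnK.
by congr F; apply/eqP; rewrite eqn_leq -ltnS ltn_divLR // lt_j leq_divRL.
Qed.

Lemma leq_ceil_divn_mul (m d : nat) : (0 < d)%N -> (m <= ceil_divn m d * d)%N.
Proof.
move=> d_gt0; rewrite /ceil_divn.
have := divn_eq (m + d.-1) d; have := ltn_pmod (m + d.-1) d_gt0; lia.
Qed.

Lemma ceil_divn_gt0 (m d : nat) : (0 < m)%N -> (0 < d)%N -> (0 < ceil_divn m d)%N.
Proof. by move=> m_gt0 d_gt0; rewrite divn_gt0 //; lia. Qed.

(** A common answer confines both ranks to [[r, r + delta)]. The half-open window makes a rank gap
    of exactly [delta] enough to separate two multisets. *)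
Lemma drankA_answer_dist (delta i : nat) (S T : {mset nat}) (r : int) :
  drankA_answer delta i S r -> drankA_answer delta i T r ->
  (rank i S < rank i T + delta)%N.
Proof. by rewrite /drankA_answer; lia. Qed.

Lemma drankA_structure_count (n delta ell b : nat) :
  (0 < delta)%N -> (0 < ell)%N -> drankA_structure n delta ell b ->
  ((maxn (ell %/ delta) 1).+1 ^ (n %/ ceil_divn delta ell) <= 2 ^ b)%N.
Proof.
move=> delta_gt0 ell_gt0 D.
set M := maxn _ _; set c := ceil_divn _ _; set m := (n %/ c)%N.
pose w := minn delta ell.
have c_gt0 : (0 < c)%N by apply: ceil_divn_gt0.
have le_delta : (delta <= c * w)%N.
  rewrite /w /minn; case: ifP => _; first by rewrite leq_pmull.
  exact: leq_ceil_divn_mul.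
(* If [delta <= ell], then [M = ell %/ delta] and [w = delta]; otherwise [M = 1] and [w = ell]. *)
have le_ell v : (v <= M)%N -> (v * w <= ell)%N.
  rewrite /M /w => le_v; case: (leqP delta ell) => [le_de|lt_ed].
    rewrite -leq_divRL //; apply: leq_trans le_v _.
    by rewrite geq_max leqnn divn_gt0.
  by move: le_v; rewrite divn_small //; case: v => [|[|]] //; lia.
(* The default [ord0] keeps [val_at t k] at most [M] even for [k >= m], so the multiplicity bound
   holds at every index. *)
pose val_at (t : m.-tuple 'I_M.+1) k : nat := nth ord0 t k.
pose S t := mset_of_mult (m * c) (fun j => val_at t (j %/ c) * w)%N.
have bS t : bounded_mset n ell (S t).
  apply: bounded_mset_of_mult => [|j]; first exact: leq_trunc_div.
  by apply: le_ell; rewrite -ltnS ltn_ord.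
have rankS t k : (k < m)%N ->
    rank (k.+1 * c) (S t) = (c * (\sum_(0 <= i < k) val_at t i * w + val_at t k * w))%N.
  move=> lt_km; rewrite rank_mset_of_mult; last by rewrite leq_mul2r lt_km orbT.
  by rewrite (sum_blocks _ _ (fun i => val_at t i * w)%N) // big_nat_recr.
have enc_inj : injective (fun t => encode D (S t)).
  move=> t u enc_tu.
  (* Stated for arbitrary [x] and [y] because it is applied in both directions below. *)
  have close x y k : encode D (S x) = encode D (S y) -> (k < m)%N ->
      (rank (k.+1 * c) (S x) < rank (k.+1 * c) (S y) + delta)%N.
    move=> enc_xy lt_km.
    have univ : in_universe n (k.+1 * c).
      rewrite /in_universe muln_gt0 c_gt0 /=.
      by apply: leq_trans (leq_trunc_div n c); rewrite leq_mul2r lt_km orbT.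
    apply: (@drankA_answer_dist _ _ _ _ (query D (encode D (S x)) (k.+1 * c))).
      exact: queryP.
    by rewrite enc_xy; apply: queryP.
  have eq_val k : (k < m)%N -> val_at t k = val_at u k.
    (* By strong induction the blocks before [k] contribute equally, so the ranks at the end of
       block [k] differ only through the [k]-th values. *)
    elim/ltn_ind: k => k IHk lt_km.
    have := close _ _ _ enc_tu lt_km; have := close _ _ _ (esym enc_tu) lt_km.
    rewrite !rankS //.
    have -> : (\sum_(0 <= i < k) val_at t i * w = \sum_(0 <= i < k) val_at u i * w)%N.
      by apply: eq_big_nat => i /= lt_ik; rewrite IHk //; lia.
    (* Here [d >= a + 1], so the two sides differ by at least [c * w], which is at least [delta] by
       [le_delta]. *)
    have step a d s : (a < d)%N ->
        (c * (s + d * w) < c * (s + a * w) + delta)%N -> False.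
      by move=> lt_ad; nia.
    move=> lt1 lt2; case: (ltngtP (val_at t k) (val_at u k)) => // lt_v.
      by case: (step _ _ _ lt_v lt1).
    by case: (step _ _ _ lt_v lt2).
  apply: val_inj; apply: (@eq_from_nth _ ord0); first by rewrite !size_tuple.
  by move=> k; rewrite size_tuple => lt_km; apply: val_inj; apply: eq_val.
by have := leq_card _ enc_inj; rewrite !card_tuple card_ord card_bool.
Qed.

Theorem theorem6 (R : realType) (n delta ell b : nat)
    (n_gt0 : (0 < n)%N) (delta_gt0 : (0 < delta)%N) (ell_gt0 : (0 < ell)%N)
    (D : drankA_structure n delta ell b) :
  (n %/ ceil_divn delta ell)%:R * lg ((maxn (ell %/ delta) 1 + 1)%:R : R)
    <= b%:R.
Proof.
have := drankA_structure_count n delta ell b delta_gt0 ell_gt0 D.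
rewrite addn1; set m := (n %/ _)%N; set M := maxn _ _ => le_pow.
have ln2_gt0 : 0 < ln (2 : R) by apply: ln_gt0; rewrite ltr1n.
(* Clearing [ln 2] and moving the factors [m] and [b] into exponents leaves the logarithm of the
   counting bound. *)
rewrite /lg mulrA ler_pdivrMr // !mulr_natl -!lnXn ?ltr0Sn //.
by rewrite ler_ln ?posrE ?exprn_gt0 ?ltr0Sn // -!natrX ler_nat.
Qed.
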